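(* Let $\mathcal H$ be a real Hilbert space, $t_0>0$, let $f\in\mathcal C^2(\mathcal H)$ be convex with $S:=\operatorname{argmin}_{\mathcal H}f\neq\emptyset$, and let $e\in\mathcal C^1([t_0,+\infty[,\mathcal H)$ satisfy $\int_{t_0}^{+\infty}t\|e(t)\|dt<+\infty$ and $\int_{t_0}^{+\infty}t\|\dot e(t)\|dt<+\infty$. Let $\alpha>3$ and $\beta>0$. Then for any solution trajectory $x$ of $$\ddot x(t)+\frac{\alpha}{t}\dot x(t)+\beta\frac{d}{dt}\big(\nabla f(x(t))+e(t)\big)+\nabla f(x(t))+e(t)=0$$ the following hold: (i) $f(x(t))-\inf_{\mathcal H}f=o(1/t^2)$ as $t\to+\infty$; (ii) $\int_{t_0}^{+\infty}t^2\|\nabla f(x(t))\|^2dt<+\infty$; (iii) $\int_{t_0}^{+\infty}t\,(f(x(t))-\min_{\mathcal H}f)dt<+\infty$; (iv) for any $x^\star\in S$, $\int_{t_0}^{+\infty}t\langle\nabla f(x(t)),x(t)-x^\star\rangle dt<+\infty$; (v) $\int_{t_0}^{+\infty}t\|\dot x(t)\|^2dt<+\infty$; (vi) $\|\dot x(t)\|=o(1/t)$ as $t\to+\infty$. *)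

(* Defs.v *)
From HB Require Import structures.
From mathcomp Require Import all_boot all_order all_algebra.
From mathcomp Require Import all_classical all_reals all_analysis.
Set Implicit Arguments. Unset Strict Implicit. Unset Printing Implicit Defensive.
Import Order.TTheory GRing.Theory Num.Theory.
Import numFieldNormedType.Exports.
Local Open Scope classical_set_scope.
Local Open Scope ring_scope.

(* A real Hilbert space is a complete normed space H whose norm comes from
   an inner product [ip]: symmetric, bilinear, and |x| = sqrt <x,x>. *)
Definition is_inner_product {R : realType} (H : completeNormedModType R)
  (ip : H -> H -> R) : Prop :=
  [/\ (forall x y, ip x y = ip y x),
      (forall (a : R) x y z, ip (a *: x + y) z = a * ip x z + ip y z) &
      (forall x, `|x| = Num.sqrt (ip x x))].

Definition convex_fun {R : realType} (H : normedModType R) (f : H -> R) : Prop :=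
  forall (x y : H) (l : R), 0 <= l <= 1 ->
    f (l *: x + (1 - l) *: y) <= l * f x + (1 - l) * f y.

Definition is_gradient {R : realType} (H : completeNormedModType R)
  (ip : H -> H -> R) (f : H -> R) (g : H -> H) : Prop :=
  forall x, differentiable f x /\ forall v, 'd f x v = ip (g x) v.

(* f is C^2: f has a gradient g that is Frechet differentiable everywhere,
   with derivative x |-> 'd g x continuous for the operator norm. *)
Definition C2_fun {R : realType} (H : completeNormedModType R)
  (ip : H -> H -> R) (f : H -> R) (g : H -> H) : Prop :=
  is_gradient ip f g /\
  (forall x, differentiable g x) /\
  (forall x (eps : R), 0 < eps -> exists2 delta : R, 0 < delta &
     forall y, `|y - x| < delta ->
       forall v, `|'d g y v - 'd g x v| <= eps * `|v|).

(* Main.v *)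
Require Import Defs.
From HB Require Import structures.
From mathcomp Require Import all_boot all_order all_algebra.
From mathcomp Require Import all_classical all_reals all_analysis.
From mathcomp Require Import measurable_realfun ring lra.
Set Implicit Arguments. Unset Strict Implicit. Unset Printing Implicit Defensive.
Import Order.TTheory GRing.Theory Num.Theory.
Import numFieldNormedType.Exports.
Local Open Scope classical_set_scope.
Local Open Scope ring_scope.

(* Write g = grad f (x), w = g + e, p = x - xs, F = f (x) - f (xs), and fix
   2 < lam < alpha - 1 and mu = alpha - 1 - lam.  With v = lam p + t (x' + beta w) (the
   [anchor]), the Lyapunov function
     E = (|v|^2 + lam mu |p|^2) / 2 + (t^2 + (mu - 1) beta t) F
   satisfies E' <= k (1 + E) - d for large t, where k is integrable because t |e| and
   t |e'| are, and d = c1 t <p, g> + c2 t |x'|^2 + c3 t^2 |w|^2.  By Gronwall's lemma E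
   is bounded, hence d is integrable; this gives (ii)-(v).  For (i) and (vi), convexity
   gives <(g(x))', x'> >= 0, so that W = t^2 (F + |x'|^2 / 2) satisfies
   W' <= k (1 + W) with another integrable k, and therefore converges; its limit is 0
   because W / t is integrable whereas 1 / t is not. *)

Lemma ler_half1Dsqr (R : realFieldType) (y : R) : y <= (1 + y ^+ 2) / 2.
Proof. by have := sqr_ge0 (y - 1); rewrite sqrrB1; lra. Qed.

Section HalfLine.
Context {R : realType}.
Implicit Types (T t : R) (k d F G K phi dphi : R -> R).

Definition continuous_from {V : topologicalType} T (u : R -> V) : Prop :=
  forall t, T <= t -> {for t, continuous u}.

Definition is_derive_from {V : normedModType R} T (u du : R -> V) : Prop :=
  forall t, T <= t -> is_derive t 1 u (du t).

Definition ge0_integrable_from T k : Prop :=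
  [/\ continuous_from T k, forall t, T <= t -> 0 <= k t &
     lebesgue_measure.-integrable `[T, +oo[ (EFin \o k)].

Lemma is_derive_from_continuous (V : normedModType R) T (u du : R -> V) :
  is_derive_from T u du -> continuous_from T u.
Proof. by move=> uE t /uE[/derivable1_diffP/differentiable_continuous]. Qed.

Lemma derivable_is_derive_from (V : normedModType R) T (u : R -> V) :
  (forall t, T <= t -> derivable u t 1) -> is_derive_from T u (derive1 u).
Proof. by move=> du t /du; rewrite derive1E; exact: derivableP. Qed.

Lemma continuous_from_within (V : topologicalType) T (u : R -> V) :
  continuous_from T u -> {within `[T, +oo[, continuous u}.
Proof.
move=> cu; apply: continuous_in_subspaceT => t.
by rewrite inE/= in_itv/= andbT; exact: cu.
Qed.

Lemma continuous_fromXM n T k :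
  continuous_from T k -> continuous_from T (fun t => t ^+ n * k t).
Proof. by move=> ck t Tt; apply: cvgM; [exact: exprn_continuous|exact: ck]. Qed.

Lemma continuous_from_idM T k :
  continuous_from T k -> continuous_from T (fun t => t * k t).
Proof. exact: (@continuous_fromXM 1). Qed.

Lemma continuous_from_norm (V : normedModType R) T (u : R -> V) :
  continuous_from T u -> continuous_from T (fun t => `|u t|).
Proof. by move=> cu t Tt; apply: cvg_norm; exact: cu. Qed.

Lemma continuous_from_sqr_norm (V : normedModType R) T (u : R -> V) :
  continuous_from T u -> continuous_from T (fun t => `|u t| ^+ 2).
Proof. by move=> /continuous_from_norm cu t Tt; apply: cvgM; exact: cu. Qed.

Lemma nondecreasing_from_derive_ge0 T F dF : is_derive_from T F dF ->
  (forall t, T <= t -> 0 <= dF t) ->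
  forall s t, T <= s -> s <= t -> F s <= F t.
Proof.
move=> FE dF_ge0; apply: ger0_derive1_ndecry => [t|t|].
- by rewrite in_itv/= andbT => /ltW/FE[].
- by rewrite in_itv/= andbT derive1E => /ltW Tt; have [_ ->] := FE _ Tt; exact: dF_ge0.
- exact/continuous_from_within/(is_derive_from_continuous FE).
Qed.

Lemma increment_le_derive T F G dF dG :
  is_derive_from T F dF -> is_derive_from T G dG ->
  (forall t, T <= t -> dF t <= dG t) ->
  forall t, T <= t -> F t - F T <= G t - G T.
Proof.
move=> FE GE dF_le t Tt.
have GFE : is_derive_from T (G - F) (fun s => dG s - dF s).
  by move=> s Ts; apply: is_deriveB; [exact: GE|exact: FE].
have : (G - F) T <= (G - F) t.
  apply: (nondecreasing_from_derive_ge0 GFE) => // s /dF_le.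
  by rewrite subr_ge0.
by rewrite !fctE; lra.
Qed.

Lemma continuous_from_primitive T k : continuous_from T k ->
  exists K, is_derive_from T K k.
Proof.
move=> ck; pose h t := k (Num.max T t).
have ch : continuous h.
  move=> t; apply: (@continuous_comp _ _ _ (Num.max T) k).
    by apply: continuous_max; [exact: cvg_cst|exact: cvg_id].
  by apply: ck; rewrite le_max lexx.
exists (fun t => \int[lebesgue_measure]_(s in `[T - 1, t]) h s)%R => t Tt.
have [||||] := @continuous_FTC1_closed R h (T - 1) t (t + 1).
- by rewrite ltrDl.
- apply: continuous_compact_integrable; first exact: segment_compact.
  exact: continuous_subspaceT.
- by rewrite ltrBlDr (le_lt_trans Tt)// ltrDl.
- exact: ch.
by move=> dK; rewrite derive1E => Kt; split => //; rewrite Kt /h max_r.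
Qed.

Lemma continuous_from_measurable T k : continuous_from T k ->
  measurable_fun `[T, +oo[ k.
Proof.
move=> ck; apply: subspace_continuous_measurable_fun => //.
exact: continuous_from_within ck.
Qed.

Lemma integral_lty_ge0_integrable_from T k : continuous_from T k ->
  (forall t, T <= t -> 0 <= k t) ->
  (\int[lebesgue_measure]_(t in `[T, +oo[) (k t)%:E < +oo)%E ->
  ge0_integrable_from T k.
Proof.
move=> ck k_ge0 k_lty; split=> //; apply/integrableP; split.
  by apply/measurable_EFinP; exact: continuous_from_measurable.
under eq_integral => t.
  by rewrite inE/= in_itv/= andbT => Tt; rewrite ger0_norm ?k_ge0//; over.
by [].
Qed.

Lemma ge0_integrable_from_lty T k : ge0_integrable_from T k ->
  (\int[lebesgue_measure]_(t in `[T, +oo[) (k t)%:E < +oo)%E.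
Proof. by move=> [_ _ /integrable_lty]; exact. Qed.

Lemma time_norm_ge0_integrable_from (V : normedModType R) T (u : R -> V) :
  0 <= T -> continuous_from T u ->
  (\int[lebesgue_measure]_(t in `[T, +oo[) (t * `|u t|)%:E < +oo)%E ->
  ge0_integrable_from T (fun t => t * `|u t|).
Proof.
move=> T_ge0 cu; apply: integral_lty_ge0_integrable_from => [|t /(le_trans T_ge0) t_ge0].
  exact/continuous_from_idM/continuous_from_norm.
by rewrite mulr_ge0.
Qed.

Lemma ge0_integrable_from_le T k d : continuous_from T k ->
  (forall t, T <= t -> 0 <= k t <= d t) ->
  ge0_integrable_from T d -> ge0_integrable_from T k.
Proof.
move=> ck kd [_ _ d_int]; split=> // [t /kd/andP[]//|].
apply: le_integrable d_int => //.
  by apply/measurable_EFinP; exact: continuous_from_measurable.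
move=> t /=; rewrite in_itv/= andbT lee_fin => /kd/andP[k0 kdt].
by rewrite !ger0_norm// (le_trans k0).
Qed.

Lemma ge0_integrable_from_tail T T' k : T <= T' ->
  ge0_integrable_from T k -> ge0_integrable_from T' k.
Proof.
move=> TT' [ck k_ge0 k_int]; split=> [t /(le_trans TT')/ck//|t /(le_trans TT')/k_ge0//|].
by apply: integrableS k_int => //; apply: subset_itvr; rewrite bnd_simp.
Qed.

Lemma ge0_integrable_fromD T k d :
  ge0_integrable_from T k -> ge0_integrable_from T d ->
  ge0_integrable_from T (fun t => k t + d t).
Proof.
move=> [ck k_ge0 k_int] [cd d_ge0 d_int]; split=> [t Tt|t Tt|].
- by apply: cvgD; [exact: ck|exact: cd].
- by rewrite addr_ge0 ?k_ge0 ?d_ge0.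
- exact: (integrableD _ k_int d_int).
Qed.

Lemma ge0_integrable_fromZl T (c : R) k : 0 <= c ->
  ge0_integrable_from T k -> ge0_integrable_from T (fun t => c * k t).
Proof.
move=> c_ge0 [ck k_ge0 k_int]; split=> [t Tt|t Tt|].
- by apply: cvgM; [exact: cvg_cst|exact: ck].
- by rewrite mulr_ge0 ?k_ge0.
- exact: (integrableZl _ c k_int).
Qed.

Lemma ge0_integrable_from_leZl T (c : R) k d : 0 < c -> continuous_from T k ->
  (forall t, T <= t -> 0 <= k t) -> (forall t, T <= t -> c * k t <= d t) ->
  ge0_integrable_from T d -> ge0_integrable_from T k.
Proof.
move=> c_gt0 ck k_ge0 kd [cd d_ge0 d_int].
apply: (@ge0_integrable_from_le T k (fun t => c^-1 * d t)) => // [t Tt|].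
  by rewrite k_ge0//= ler_pdivlMl// kd.
by apply: ge0_integrable_fromZl; rewrite ?invr_ge0 ?ltW.
Qed.

Lemma nondecreasing_from_cvg T F M :
  (forall s t, T <= s -> s <= t -> F s <= F t) ->
  (forall t, T <= t -> F t <= M) -> cvg (F @ +oo).
Proof.
move=> F_nd F_leM; have Tmax t : T <= Num.max T t by rewrite le_max lexx.
apply: (cvgP (sup (range (fun t => F (Num.max T t))))).
have : F (Num.max T t) @[t --> +oo] --> sup (range (fun t => F (Num.max T t))).
  apply: nondecreasing_cvgr => [s t st|].
    by apply: F_nd => //; rewrite ge_max !le_max lexx st orbT.
  by exists M => _ [t _ <-]; exact: F_leM.
apply: cvg_trans; apply: near_eq_cvg; near=> t.
by rewrite max_r//; near: t; apply: nbhs_pinfty_ge; exact: num_real.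
Unshelve. all: end_near. Qed.

Lemma increment_le_integral T k K t : is_derive_from T K k -> T <= t ->
  ge0_integrable_from T k ->
  K t - K T <= fine (\int[lebesgue_measure]_(s in `[T, +oo[) (k s)%:E)%E.
Proof.
move=> KE + [ck k_ge0 k_int]; have cK := is_derive_from_continuous KE.
rewrite le_eqVlt => /predU1P[<-|Tt].
  rewrite subrr fine_ge0// integral_ge0// => s /=.
  by rewrite in_itv/= andbT lee_fin; exact: k_ge0.
rewrite -lee_fin fineK; last exact: integrable_fin_num k_int.
rewrite EFinB -(@continuous_FTC2 _ k K T t Tt).
- apply: ge0_subset_integral => //.
  + by apply/measurable_EFinP; exact: continuous_from_measurable.
  + by move=> s /=; rewrite in_itv/= andbT lee_fin; exact: k_ge0.
  + by apply: subset_itvl; rewrite bnd_simp.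
- apply: continuous_subspaceW (continuous_from_within ck).
  by apply: subset_itvl; rewrite bnd_simp.
- split.
  + by move=> s; rewrite in_itv/= => /andP[/ltW /KE[]].
  + by apply: cvg_at_right_filter; exact: cK.
  + by apply: cvg_at_left_filter; apply: cK; exact: ltW.
- by move=> s; rewrite in_itv/= => /andP[/ltW /KE[_]]; rewrite derive1E.
Qed.

Lemma bounded_primitive_integrable T k K M : is_derive_from T K k ->
  continuous_from T k -> (forall t, T <= t -> 0 <= k t) ->
  (forall t, T <= t -> K t <= M) -> ge0_integrable_from T k.
Proof.
move=> KE ck k_ge0 K_leM; apply: integral_lty_ge0_integrable_from => //.
have K_nd := nondecreasing_from_derive_ge0 KE k_ge0.
rewrite (@ge0_continuous_FTC2y _ _ K _ _ k_ge0 _ (nondecreasing_from_cvg K_nd K_leM)).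
- by rewrite -EFinB ltry.
- exact: continuous_from_within.
- by move=> t /ltW /KE[].
- by apply: cvg_at_right_filter; exact: (is_derive_from_continuous KE).
- by move=> t; rewrite in_itv/= andbT => /ltW /KE[_]; rewrite derive1E.
Qed.

Lemma integrable_bounded_primitive T k : ge0_integrable_from T k ->
  exists K M, is_derive_from T K k /\ forall t, T <= t -> K t <= M.
Proof.
move=> k_int; have [ck _ _] := k_int; have [K KE] := continuous_from_primitive ck.
exists K, (fine (\int[lebesgue_measure]_(t in `[T, +oo[) (k t)%:E)%E + K T).
by split=> // t Tt; rewrite -lerBlDr increment_le_integral.
Qed.

Lemma ge0_integrable_from_extend T T' k : T <= T' -> continuous_from T k ->
  (forall t, T <= t -> 0 <= k t) ->
  ge0_integrable_from T' k -> ge0_integrable_from T k.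
Proof.
move=> TT' ck k_ge0 k_int; have [K KE] := continuous_from_primitive ck.
have KE' : is_derive_from T' K k by move=> t /(le_trans TT')/KE.
pose I := fine (\int[lebesgue_measure]_(t in `[T', +oo[) (k t)%:E)%E.
apply: (bounded_primitive_integrable (M := I + K T') KE) => // t Tt.
apply: (@le_trans _ _ (K (Num.max T' t))).
  by apply: nondecreasing_from_derive_ge0 KE k_ge0 _ _ Tt _; rewrite le_max lexx orbT.
by rewrite -lerBlDr (increment_le_integral KE')// le_max lexx.
Qed.

Lemma inv_not_integrable_from T : 0 < T -> ~ ge0_integrable_from T GRing.inv.
Proof.
move=> T_gt0 inv_int; have pos t : T <= t -> 0 < t := lt_le_trans T_gt0.
pose I := fine (\int[lebesgue_measure]_(t in `[T, +oo[) (t^-1)%:E)%E.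
pose t := Num.max T (expR (I + 1 + ln T)).
have Tt : T <= t by rewrite le_max lexx.
have lnE : is_derive_from T (@ln R) GRing.inv by move=> s /pos; exact: is_derive1_ln.
have : ln (expR (I + 1 + ln T)) <= ln t.
  by rewrite ler_ln ?posrE ?expR_gt0 ?pos// le_max lexx orbT.
by rewrite expRK; have := increment_le_integral lnE Tt inv_int; rewrite -/I; lra.
Qed.

Lemma gronwall T (u du : R -> R) k K :
  is_derive_from T u du -> is_derive_from T K k ->
  (forall t, T <= t -> du t <= k t * u t) ->
  forall t, T <= t -> u t <= u T * expR (K t - K T).
Proof.
move=> uE KE du_le t Tt; pose h s := u s * expR (- K s).
have hE : is_derive_from T h (fun s => (du s - k s * u s) * expR (- K s)).
  move=> s Ts.
  have expE : is_derive s 1 (expR \o (fun r => - K r)) (expR (- K s) * - k s).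
    exact: is_derive1_comp (is_derive_expR _) (is_deriveN (KE _ Ts)).
  apply: is_derive_eq (is_deriveM (uE _ Ts) expE) _.
  by rewrite /GRing.scale/=; ring.
have : h t <= h T.
  have := increment_le_derive hE (fun s _ => is_derive_cst (0 : R) s 1) _ Tt.
  rewrite subrr subr_le0; apply=> s Ts.
  by rewrite mulr_le0_ge0 ?expR_ge0// subr_le0 du_le.
rewrite -(ler_pM2r (expR_gt0 (K t))) -!mulrA -!expRD addNr expR0 mulr1.
by rewrite addrC.
Qed.

Lemma gronwall_bounded T phi dphi k :
  is_derive_from T phi dphi -> (forall t, T <= t -> 0 <= phi t) ->
  ge0_integrable_from T k -> (forall t, T <= t -> dphi t <= k t * (1 + phi t)) ->
  exists B, forall t, T <= t -> phi t <= B.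
Proof.
move=> phiE phi_ge0 /integrable_bounded_primitive[K [M [KE K_leM]]] dphi_le.
exists ((1 + phi T) * expR (M - K T)) => t Tt.
have phi1E : is_derive_from T (fun s => 1 + phi s) dphi.
  move=> s Ts; apply: is_derive_eq (is_deriveD (is_derive_cst (1 : R) s 1) (phiE _ Ts)) _.
  exact: add0r.
apply: (@le_trans _ _ (1 + phi t)); first by rewrite lerDr.
apply: le_trans (gronwall phi1E KE dphi_le Tt) _.
by rewrite ler_wpM2l ?addr_ge0 ?phi_ge0// ler_expR lerD2r K_leM.
Qed.

Lemma dissipation_integrable T phi dphi k d :
  is_derive_from T phi dphi -> (forall t, T <= t -> 0 <= phi t) ->
  ge0_integrable_from T k ->
  continuous_from T d -> (forall t, T <= t -> 0 <= d t) ->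
  (forall t, T <= t -> dphi t <= k t - d t) -> ge0_integrable_from T d.
Proof.
move=> phiE phi_ge0 /integrable_bounded_primitive[K [M [KE K_leM]]] cd d_ge0 dphi_le.
have [D DE] := continuous_from_primitive cd.
apply: (bounded_primitive_integrable (M := M - K T + phi T + D T) DE) => // t Tt.
have phiDE : is_derive_from T (phi + D) (fun s => dphi s + d s).
  by move=> s Ts; apply: is_deriveD; [exact: phiE|exact: DE].
have /(_ _ _ Tt) := increment_le_derive phiDE KE.
rewrite !fctE => incr; have := K_leM _ Tt; have := phi_ge0 _ Tt.
suff : phi t + D t - (phi T + D T) <= K t - K T by lra.
by apply: incr => s /dphi_le; lra.
Qed.

Lemma gronwall_integrable_rate T phi dphi k d :
  is_derive_from T phi dphi -> (forall t, T <= t -> 0 <= phi t) ->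
  ge0_integrable_from T k -> (forall t, T <= t -> 0 <= d t) ->
  (forall t, T <= t -> dphi t <= k t * (1 + phi t) - d t) ->
  exists2 r, ge0_integrable_from T r & forall t, T <= t -> dphi t <= r t - d t.
Proof.
move=> phiE phi_ge0 k_int d_ge0 dphi_le; have [_ k_ge0 _] := k_int.
have [t Tt|B phi_leB] := gronwall_bounded phiE phi_ge0 k_int.
  by apply: le_trans (dphi_le _ Tt) _; rewrite gerBl d_ge0.
have B_ge0 : 0 <= B := le_trans (phi_ge0 _ (lexx T)) (phi_leB _ (lexx T)).
exists (fun t => (1 + B) * k t) => [|t Tt].
  by apply: ge0_integrable_fromZl => //; rewrite addr_ge0.
by rewrite (le_trans (dphi_le _ Tt))// lerD2r mulrC ler_wpM2r ?k_ge0// lerD2l phi_leB.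
Qed.

Lemma gronwall_dissipation T phi dphi k d :
  is_derive_from T phi dphi -> (forall t, T <= t -> 0 <= phi t) ->
  ge0_integrable_from T k ->
  continuous_from T d -> (forall t, T <= t -> 0 <= d t) ->
  (forall t, T <= t -> dphi t <= k t * (1 + phi t) - d t) ->
  ge0_integrable_from T d.
Proof.
move=> phiE phi_ge0 k_int cd d_ge0 dphi_le.
have [r r_int dphi_le_r] := gronwall_integrable_rate phiE phi_ge0 k_int d_ge0 dphi_le.
exact: dissipation_integrable phiE phi_ge0 r_int cd d_ge0 dphi_le_r.
Qed.

Lemma derive_le_integrable_cvg T phi dphi r :
  is_derive_from T phi dphi -> (forall t, T <= t -> 0 <= phi t) ->
  ge0_integrable_from T r -> (forall t, T <= t -> dphi t <= r t) ->
  cvg (phi @ +oo).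
Proof.
move=> phiE phi_ge0 r_int dphi_le; have [_ r_ge0 _] := r_int.
have [K [M [KE K_leM]]] := integrable_bounded_primitive r_int.
have -> : phi = K - (K - phi) by rewrite opprB addrC subrK.
apply: is_cvgB.
  exact: nondecreasing_from_cvg (nondecreasing_from_derive_ge0 KE r_ge0) K_leM.
have KphiE : is_derive_from T (K - phi) (fun s => r s - dphi s).
  by move=> s Ts; apply: is_deriveB; [exact: KE|exact: phiE].
apply: (@nondecreasing_from_cvg T _ M) => [|t Tt].
  by apply: nondecreasing_from_derive_ge0 KphiE _ => s /dphi_le; rewrite subr_ge0.
by rewrite /= lerBlDr (le_trans (K_leM _ Tt))// lerDl phi_ge0.
Qed.

Lemma gronwall_cvg T phi dphi k :
  is_derive_from T phi dphi -> (forall t, T <= t -> 0 <= phi t) ->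
  ge0_integrable_from T k -> (forall t, T <= t -> dphi t <= k t * (1 + phi t)) ->
  cvg (phi @ +oo).
Proof.
move=> phiE phi_ge0 k_int dphi_le.
have [//|t /dphi_le|r r_int dphi_le_r] :=
    gronwall_integrable_rate (d := cst 0) phiE phi_ge0 k_int.
  by rewrite subr0.
by apply: derive_le_integrable_cvg phiE phi_ge0 r_int _ => t /dphi_le_r; rewrite subr0.
Qed.

Lemma cvg0_div_id_integrable T phi : 0 < T ->
  ge0_integrable_from T (fun t => phi t / t) -> cvg (phi @ +oo) -> phi @ +oo --> 0.
Proof.
move=> T_gt0 phi_int cphi; set l := lim (phi @ +oo) in cphi.
have l_ge0 : 0 <= l.
  apply: limr_ge => //; near=> t; have Tt : T <= t.
    by near: t; apply: nbhs_pinfty_ge; exact: num_real.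
  have [_ /(_ _ Tt) + _] := phi_int.
  by rewrite pmulr_lge0// invr_gt0 (lt_le_trans T_gt0).
move: l_ge0; rewrite le_eqVlt => /predU1P[l0|l_gt0]; first by rewrite [X in _ --> X]l0.
have l2_gt0 : 0 < l / 2 by rewrite divr_gt0.
have [M [_ phi_gt]] : \forall t \near +oo, l / 2 < phi t.
  by apply: (cvgr_gt l) => //; rewrite gtr_pMr// invf_lt1// ltr1n.
pose T' := Num.max T (M + 1).
have TT' : T <= T' by rewrite le_max lexx.
have T'_gt0 : 0 < T' := lt_le_trans T_gt0 TT'.
case: (inv_not_integrable_from T'_gt0).
have pos t : T' <= t -> 0 < t := lt_le_trans T'_gt0.
apply: (ge0_integrable_from_leZl l2_gt0) (ge0_integrable_from_tail TT' phi_int) => t T't.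
- by apply: inv_continuous; rewrite gt_eqF// pos.
- by rewrite invr_ge0 ltW// pos.
- rewrite ler_pM2r ?invr_gt0 ?pos//; apply/ltW/phi_gt; apply: lt_le_trans T't.
  by rewrite lt_max ltrDl ltr01 orbT.
Unshelve. all: end_near. Qed.

End HalfLine.

Lemma is_derive_bilinear {R : realType} {U V W : normedModType R}
    (B : {bilinear U -> V -> W}) (u : R -> U) (v : R -> V) (t : R) du dv :
  continuous (fun p : U * V => B p.1 p.2) ->
  is_derive t 1 u du -> is_derive t 1 v dv ->
  is_derive t 1 (fun s => B (u s) (v s)) (B du (v t) + B (u t) dv).
Proof.
move=> cB [/derivable1_diffP du1 <-] [/derivable1_diffP dv1 <-].
have dB := differentiable_bilin (u t, v t) cB.
have duv : differentiable (fun s => (u s, v s)) t by exact: differentiable_pair.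
have dBuv := differentiable_comp duv dB.
split; first exact: diff_derivable.
rewrite deriveE// (diff_comp duv dB) /= diff_bilin//= (diff_pair du1 dv1)/=.
by rewrite -!deriveE// addrC.
Qed.

Lemma scale_is_bilinear {R : realType} {V : normedModType R} :
  bilinear_for (GRing.Scale.Law.clone _ _ *:%R _) (GRing.Scale.Law.clone _ _ *:%R _)
    (fun (a : R^o) (v : V) => a *: v).
Proof.
split=> [v|b] a u w /=; first by rewrite scalerDl scalerA.
by rewrite scalerDr !scalerA mulrC.
Qed.

Lemma is_derive_scale {R : realType} {V : normedModType R} (a : R -> R) (u : R -> V)
    (t : R) da du :
  is_derive t 1 a da -> is_derive t 1 u du ->
  is_derive t 1 (fun s => a s *: u s) (da *: u t + a t *: du).
Proof.
pose scaleM := bilinear_isBilinear.Build R R^o V V _ _ _ scale_is_bilinear.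
pose scaleB : {bilinear R^o -> V -> V} :=
  HB.pack (fun (a : R^o) (v : V) => a *: v) scaleM.
exact: (is_derive_bilinear (B := scaleB) scale_continuous).
Qed.

Section InnerProduct.
Context {R : realType} {H : completeNormedModType R} {ip : H -> H -> R}.
Hypothesis ipP : is_inner_product ip.
Implicit Types u v w : H.

Lemma ipC u v : ip u v = ip v u.
Proof. by have [] := ipP. Qed.

Lemma ip_linearl (a : R) u v w : ip (a *: u + v) w = a * ip u w + ip v w.
Proof. by have [_ h _] := ipP. Qed.

Lemma ipDl u v w : ip (u + v) w = ip u w + ip v w.
Proof. by rewrite -[u]scale1r ip_linearl mul1r scale1r. Qed.

Lemma ipDr u v w : ip w (u + v) = ip w u + ip w v.
Proof. by rewrite ipC ipDl ![ip w _]ipC. Qed.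

Lemma ip0l u : ip 0 u = 0.
Proof. by apply: (addrI (ip 0 u)); rewrite -ipDl !addr0. Qed.

Lemma ipZl (a : R) u v : ip (a *: u) v = a * ip u v.
Proof. by rewrite -[a *: u]addr0 ip_linearl ip0l addr0. Qed.

Lemma ipZr (a : R) u v : ip u (a *: v) = a * ip u v.
Proof. by rewrite ipC ipZl ipC. Qed.

Lemma ipNl u v : ip (- u) v = - ip u v.
Proof. by rewrite -scaleN1r ipZl mulN1r. Qed.

Lemma ipNr u v : ip u (- v) = - ip u v.
Proof. by rewrite ipC ipNl ipC. Qed.

Lemma ip_sqr u : ip u u = `|u| ^+ 2.
Proof.
have [_ _ norm_ip] := ipP; rewrite norm_ip.
have [/sqr_sqrtr->//|ip_lt0] := leP 0 (ip u u).
have : `|u| = 0 by rewrite norm_ip ler0_sqrtr// ltW.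
by move=> /normr0_eq0 u0; rewrite u0 ip0l ltxx in ip_lt0.
Qed.

Lemma sqr_normD u v : `|u + v| ^+ 2 = `|u| ^+ 2 + 2 * ip u v + `|v| ^+ 2.
Proof. by rewrite -!ip_sqr !(ipDl, ipDr) (ipC v u); ring. Qed.

Lemma sqr_normB u v : `|u - v| ^+ 2 = `|u| ^+ 2 - 2 * ip u v + `|v| ^+ 2.
Proof. by rewrite sqr_normD ipNr normrN; ring. Qed.

Lemma ip_cauchy_schwarz u v : `|ip u v| <= `|u| * `|v|.
Proof.
have [->|v0] := eqVneq v 0; first by rewrite ipC ip0l !normr0 mulr0.
have v_gt0 : 0 < `|v| ^+ 2 by rewrite exprn_gt0// normr_gt0.
rewrite -ler_sqr ?nnegrE ?mulr_ge0// real_normK ?num_real// exprMn.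
have : 0 <= `|u - (ip u v / `|v| ^+ 2) *: v| ^+ 2 * `|v| ^+ 2.
  by rewrite mulr_ge0// sqr_ge0.
rewrite -subr_ge0; congr (0 <= _).
rewrite sqr_normB ipZr normrZ exprMn real_normK ?num_real//.
by field; rewrite normr_eq0.
Qed.

Lemma ip_le_norm u v : ip u v <= `|u| * `|v|.
Proof. exact: le_trans (ler_norm _) (ip_cauchy_schwarz _ _). Qed.

Lemma ip_ge_norm u v : - (`|u| * `|v|) <= ip u v.
Proof. by rewrite lerNl (le_trans (ler_norm _))// normrN ip_cauchy_schwarz. Qed.

(* Polarization reduces the continuity of [ip] to that of the norm. *)
Lemma cvg_ip (T : Type) (F : set_system T) {FF : Filter F} (u v : T -> H) a b :
  u @ F --> a -> v @ F --> b -> (fun s => ip (u s) (v s)) @ F --> ip a b.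
Proof.
have polarization p q : ip p q = (`|p + q| ^+ 2 - `|p| ^+ 2 - `|q| ^+ 2) / 2.
  by rewrite sqr_normD; field.
have cvg_sqr_norm (z : T -> H) c : z @ F --> c ->
    (fun s => `|z s| ^+ 2) @ F --> `|c| ^+ 2.
  by move=> /cvg_norm zc; rewrite expr2; exact: cvgM.
move=> ua vb; rewrite polarization; under eq_fun do rewrite polarization.
apply: cvgM; last exact: cvg_cst.
do 2!(apply: cvgB; last exact: cvg_sqr_norm).
by apply: cvg_sqr_norm; exact: cvgD.
Qed.

Lemma continuous_from_ip T (u v : R -> H) : continuous_from T u -> continuous_from T v ->
  continuous_from T (fun t => ip (u t) (v t)).
Proof. by move=> cu cv t Tt; apply: cvg_ip; [exact: cu|exact: cv]. Qed.

Lemma is_derive_ip (u v : R -> H) (t : R) du dv :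
  is_derive t 1 u du -> is_derive t 1 v dv ->
  is_derive t 1 (fun s => ip (u s) (v s)) (ip du (v t) + ip (u t) dv).
Proof.
have ip_bilinear : bilinear_for
    (GRing.Scale.Law.clone _ _ *:%R _) (GRing.Scale.Law.clone _ _ *:%R _)
    (ip : H -> H -> R^o).
  by split=> w a y z; rewrite ?(ipC w) ip_linearl.
pose ipM := bilinear_isBilinear.Build R H H R^o _ _ _ ip_bilinear.
pose ipB : {bilinear H -> H -> R^o} := HB.pack ip ipM.
apply: (is_derive_bilinear (B := ipB)) => z.
by apply: cvg_ip; [exact: cvg_fst|exact: cvg_snd].
Qed.

Lemma is_derive_sqr_norm (u : R -> H) (t : R) du : is_derive t 1 u du ->
  is_derive t 1 (fun s => `|u s| ^+ 2) (2 * ip (u t) du).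
Proof.
move=> uE; under eq_fun do rewrite -ip_sqr.
by apply: is_derive_eq (is_derive_ip uE uE) _; rewrite (ipC du) mulr_natl mulr2n.
Qed.

Lemma integrable_derive_norm_bounded T (u du : R -> H) k : is_derive_from T u du ->
  ge0_integrable_from T k -> (forall t, T <= t -> `|du t| <= k t) ->
  exists C, forall t, T <= t -> `|u t| <= C.
Proof.
move=> uE k_int du_le; have [_ k_ge0 _] := k_int.
have nE : is_derive_from T (fun t => `|u t| ^+ 2) (fun t => 2 * ip (u t) (du t)).
  by move=> t /uE; exact: is_derive_sqr_norm.
have [|t Tt|B n_leB] := gronwall_bounded nE _ k_int; first by move=> t _; exact: sqr_ge0.
  have n2 : 2 * `|u t| <= 1 + `|u t| ^+ 2.
    by have := ler_half1Dsqr `|u t|; lra.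
  have := ip_le_norm (u t) (du t); have := ler_wpM2l (normr_ge0 (u t)) (du_le _ Tt).
  by have := ler_wpM2l (k_ge0 _ Tt) n2; lra.
exists (Num.sqrt B) => t Tt; rewrite -[leLHS]ger0_norm// -sqrtr_sqr.
by rewrite ler_wsqrtr// n_leB.
Qed.

Lemma is_derive_grad_comp (f : H -> R) g (x : R -> H) (t : R) dx :
  is_gradient ip f g -> is_derive t 1 x dx ->
  is_derive t 1 (fun s => f (x s)) (ip (g (x t)) dx).
Proof.
move=> /(_ (x t))[df dfE] [/derivable1_diffP dx1 <-].
have dfx : differentiable (f \o x) t by exact: differentiable_comp.
split; first exact: diff_derivable.
by rewrite deriveE// diff_comp//= dfE -deriveE.
Qed.

Lemma convex_gradient_le (f : H -> R) g u v :
  convex_fun f -> is_gradient ip f g -> f u + ip (g u) (v - u) <= f v.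
Proof.
move=> cf /(_ u)[df dfE]; rewrite -lerBrDl -dfE -deriveE//.
have quotient : (fun h => h^-1 *: (f (h *: (v - u) + u) - f u)) @ 0^'+ --> 'D_(v - u) f u.
  exact/cvg_dnbhs_at_right/diff_derivable.
apply: (cvgr_to_le quotient); near=> h.
have h_gt0 : 0 < h by [].
have h_le1 : h <= 1 by near: h; exact: nbhs_right_le.
rewrite /GRing.scale/= mulrC ler_pdivrMr//.
have -> : h *: (v - u) + u = h *: v + (1 - h) *: u.
  by rewrite scalerBr scalerBl scale1r addrAC -addrA.
by have := cf v u h; rewrite ltW// h_le1 => /(_ isT); lra.
Unshelve. all: end_near. Qed.

Lemma convex_gradient_monotone (f : H -> R) g u v :
  convex_fun f -> is_gradient ip f g -> 0 <= ip (g u - g v) (u - v).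
Proof.
move=> cf gf; have := convex_gradient_le u v cf gf.
have := convex_gradient_le v u cf gf.
by rewrite !(ipDl, ipDr, ipNl, ipNr); lra.
Qed.

Lemma monotone_derive_ip_ge0 (u v : R -> H) (t : R) du dv :
  is_derive t 1 u du -> is_derive t 1 v dv ->
  (forall s, 0 <= ip (u s - u t) (v s - v t)) -> 0 <= ip du dv.
Proof.
move=> [udiff <-] [vdiff <-] mono; apply: (cvgr_to_ge (cvg_ip udiff vdiff)).
apply: nearW => h; rewrite ipZl ipZr mulrA -expr2 mulr_ge0 ?sqr_ge0//.
exact: mono.
Qed.

End InnerProduct.

Section Trajectory.
Context {R : realType} {H : completeNormedModType R} {ip : H -> H -> R}.
Hypothesis ipP : is_inner_product ip.
Variables (f : H -> R) (gradf : H -> H) (xs : H) (e x : R -> H) (t0 alpha beta : R).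
Hypothesis f_convex : convex_fun f.
Hypothesis f_grad : is_gradient ip f gradf.
Hypothesis xs_min : forall y, f xs <= f y.
Hypothesis t0_gt0 : 0 < t0.
Hypothesis beta_gt0 : 0 < beta.

Let g t := gradf (x t).
Let w t := g t + e t.
Let q := derive1 x.
Let p t := x t - xs.
Let F t := f (x t) - f xs.

Hypothesis eE : is_derive_from t0 e (derive1 e).
Hypothesis e_int : ge0_integrable_from t0 (fun t => t * `|e t|).
Hypothesis de_int : ge0_integrable_from t0 (fun t => t * `|derive1 e t|).
Hypothesis xE : is_derive_from t0 x q.
Hypothesis wE : is_derive_from t0 w (derive1 w).
Hypothesis dqE : is_derive_from t0 q (derive1 q).
Hypothesis ode : forall t, t0 <= t ->
  derive1 q t + (alpha / t) *: q t + beta *: derive1 w t + w t = 0.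

Let time_gt0 t : t0 <= t -> 0 < t.
Proof. exact: lt_le_trans. Qed.

Let time_ge0 t : t0 <= t -> 0 <= t.
Proof. by move=> /time_gt0/ltW. Qed.

Let qE : is_derive_from t0 q
  (fun t => - (alpha / t) *: q t - beta *: derive1 w t - w t).
Proof.
move=> t t0t; apply: is_derive_eq (dqE t0t) _.
have /eqP := ode t0t; rewrite addr_eq0 => /eqP <-.
by rewrite scaleNr -opprD -addrA [RHS]addrC addrK.
Qed.

Lemma is_derive_gradient :
  is_derive_from t0 g (fun t => derive1 w t - derive1 e t).
Proof.
move=> t t0t; have := is_deriveB (wE t0t) (eE t0t).
by rewrite [X in is_derive _ _ X](_ : _ = g)//; apply/funext => s; rewrite /= !fctE addrK.
Qed.

Lemma is_derive_displacement : is_derive_from t0 p q.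
Proof.
move=> t t0t; rewrite -[q t]subr0.
exact: is_deriveB (xE t0t) (is_derive_cst xs t 1).
Qed.

Lemma is_derive_gap : is_derive_from t0 F (fun t => ip (g t) (q t)).
Proof.
move=> t t0t; rewrite -[ip _ _]subr0.
exact: is_deriveB (is_derive_grad_comp f_grad (xE t0t)) (is_derive_cst (f xs : R) t 1).
Qed.

Lemma gap_ge0 t : 0 <= F t.
Proof. by rewrite subr_ge0. Qed.

Lemma gap_le t : F t <= ip (p t) (g t).
Proof.
have := convex_gradient_le (x t) xs f_convex f_grad.
by rewrite -opprB (ipNr ipP) (ipC ipP); rewrite /F; lra.
Qed.

Lemma gradient_derive_velocity_ge0 t : t0 <= t ->
  0 <= ip (q t) (derive1 w t - derive1 e t).
Proof.
move=> t0t; rewrite (ipC ipP).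
apply: (monotone_derive_ip_ge0 ipP (is_derive_gradient t0t) (xE t0t)) => s.
exact: (convex_gradient_monotone ipP _ _ f_convex f_grad).
Qed.

Let p_cont : continuous_from t0 p := is_derive_from_continuous is_derive_displacement.
Let q_cont : continuous_from t0 q := is_derive_from_continuous qE.
Let g_cont : continuous_from t0 g := is_derive_from_continuous is_derive_gradient.
Let w_cont : continuous_from t0 w := is_derive_from_continuous wE.

Lemma time_ip_gradient_continuous : continuous_from t0 (fun t => t * ip (p t) (g t)).
Proof. exact: continuous_from_idM (continuous_from_ip ipP p_cont g_cont). Qed.

Lemma time_ip_gradient_ge0 t : t0 <= t -> 0 <= t * ip (p t) (g t).
Proof. by move=> /time_ge0 t_ge0; rewrite mulr_ge0// (le_trans (gap_ge0 t)) ?gap_le. Qed.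

Lemma time_sqr_velocity_continuous : continuous_from t0 (fun t => t * `|q t| ^+ 2).
Proof. exact: continuous_from_idM (continuous_from_sqr_norm q_cont). Qed.

Lemma time_perturbation_bounded : exists C, forall t, t0 <= t -> t * `|e t| <= C.
Proof.
have teE : is_derive_from t0 (fun t => t *: e t)
    (fun t => (1 : R) *: e t + t *: derive1 e t).
  by move=> t t0t; exact: is_derive_scale (is_derive_id t 1) (eE t0t).
have rate_int : ge0_integrable_from t0
    (fun t => t0^-1 * (t * `|e t|) + t * `|derive1 e t|).
  apply: ge0_integrable_fromD de_int; apply: ge0_integrable_fromZl => //.
  by rewrite invr_ge0 ltW.
have [t t0t|C te_leC] := integrable_derive_norm_bounded ipP teE rate_int.
  rewrite scale1r (le_trans (ler_normD _ _))// normrZ (ger0_norm (time_ge0 t0t)) lerD2r.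
  by rewrite mulrA ler_peMl// mulrC ler_pdivlMr// mul1r.
exists C => t t0t; apply: le_trans (te_leC _ t0t).
by rewrite normrZ ger0_norm// time_ge0.
Qed.

Lemma time_sqr_perturbation_integrable :
  ge0_integrable_from t0 (fun t => t ^+ 2 * `|e t| ^+ 2).
Proof.
have [C te_leC] := time_perturbation_bounded.
have te_ge0 t : t0 <= t -> 0 <= t * `|e t| by move=> t0t; rewrite mulr_ge0// time_ge0.
have C_ge0 : 0 <= C := le_trans (te_ge0 _ (lexx t0)) (te_leC _ (lexx t0)).
apply: ge0_integrable_from_le (ge0_integrable_fromZl C_ge0 e_int) => [|t t0t].
  exact/continuous_fromXM/continuous_from_sqr_norm/(is_derive_from_continuous eE).
by rewrite -exprMn sqr_ge0 expr2 ler_wpM2r ?te_ge0 ?te_leC.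
Qed.

Section Lyapunov.
Variable lam : R.
Let mu := alpha - 1 - lam.
Hypothesis lam_gt2 : 2 < lam.
Hypothesis mu_gt0 : 0 < mu.

Let lam_gt0 : 0 < lam.
Proof. exact: lt_trans lam_gt2. Qed.

Definition anchor t : H := lam *: p t + t *: (q t + beta *: w t).

Definition gap_weight t : R := t * (t + (mu - 1) * beta).

Definition lyapunov t : R :=
  2^-1 * (`|anchor t| ^+ 2 + lam * mu * `|p t| ^+ 2) + gap_weight t * F t.

Definition perturbation_factor t : H :=
  lam * (t - beta) *: p t + gap_weight t *: q t.

Definition lyapunov_rate t : R :=
  (2 * t + (mu - 1) * beta) * F t - lam * (t - beta) * ip (p t) (g t)
  - mu * (t * `|q t| ^+ 2) - beta * (t * (t - beta)) * `|w t| ^+ 2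
  - ip (perturbation_factor t) (e t).

Lemma is_derive_anchor :
  is_derive_from t0 anchor (fun t => - mu *: q t - (t - beta) *: w t).
Proof.
move=> t t0t; have t_neq0 : t != 0 by rewrite gt_eqF// time_gt0.
have qwE := is_deriveD (qE t0t) (is_deriveZ beta (wE t0t)).
apply: is_derive_eq
  (is_deriveD (is_deriveZ lam (is_derive_displacement t0t))
    (is_derive_scale (is_derive_id t 1) qwE)) _.
rewrite /= !fctE /mu.
have -> : - (alpha / t) *: q t - beta *: derive1 w t - w t + beta *: derive1 w t =
    - (alpha / t) *: q t - w t by rewrite addrAC subrK.
rewrite scalerBr scalerA mulrN mulrCA divff// mulr1 scale1r /=.
have -> : - (alpha - 1 - lam) = lam + 1 - alpha by ring.
rewrite !scalerBl scalerDl scale1r scaleNr opprB !addrA.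
by rewrite [LHS](ACl (1*2*4*3*5)).
Qed.

Lemma is_derive_lyapunov : is_derive_from t0 lyapunov lyapunov_rate.
Proof.
move=> t t0t; have pE := is_derive_displacement t0t.
have weightE := is_deriveM (is_derive_id t 1)
  (is_deriveD (is_derive_id t 1) (is_derive_cst ((mu - 1) * beta) t 1)).
have normE := is_deriveD (is_derive_sqr_norm ipP (is_derive_anchor t0t))
  (is_deriveZ (lam * mu) (is_derive_sqr_norm ipP pE)).
apply: is_derive_eq
  (is_deriveD (is_deriveZ 2^-1 normE) (is_deriveM weightE (is_derive_gap t0t))) _.
rewrite /= !fctE /GRing.scale/=.
rewrite /lyapunov_rate /perturbation_factor /gap_weight /anchor /w.
move: (p t) (q t) (g t) (e t) (F t) => pt qt gt et Ft.
rewrite -!(ip_sqr ipP) !(ipDl ipP, ipDr ipP, ipNr ipP, ipZl ipP, ipZr ipP).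
rewrite (ipC ipP et gt) (ipC ipP gt qt) (ipC ipP et qt).
by field.
Qed.

(* Times at which the lower-order terms of [lyapunov_rate] are absorbed. *)
Definition late t : Prop := [/\ t0 <= t, 2 * beta <= t,
  `|(mu - 1) * beta| <= t / 2 & (mu - 1 + lam) * beta <= (lam - 2) / 2 * t].

Lemma late_from : exists2 T, t0 <= T & forall t, T <= t -> late t.
Proof.
exists (Num.max t0 (Num.max (2 * beta) (Num.max (2 * `|(mu - 1) * beta|)
  ((mu - 1 + lam) * beta / ((lam - 2) / 2))))); first by rewrite le_max lexx.
move=> t; rewrite !ge_max => /and4P[? ? ? ?]; split=> //.
  by rewrite ler_pdivlMr// mulrC.
by rewrite [leRHS]mulrC -ler_pdivrMr// divr_gt0 ?subr_gt0.
Qed.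

Lemma late_gap_weight t : late t -> 0 <= gap_weight t <= 3 / 2 * t ^+ 2.
Proof.
move=> [/time_ge0 t_ge0 _ /[!ler_norml]/andP[? ?] _].
have -> : 3 / 2 * t ^+ 2 = t * (3 / 2 * t) by ring.
rewrite mulr_ge0 ?ler_wpM2l//; lra.
Qed.

Lemma lyapunov_ge t : late t ->
  2^-1 * `|anchor t| ^+ 2 <= lyapunov t /\ lam * mu / 2 * `|p t| ^+ 2 <= lyapunov t.
Proof.
move=> /late_gap_weight/andP[weight_ge0 _].
have := mulr_ge0 weight_ge0 (gap_ge0 t); have := sqr_ge0 `|anchor t|.
have : 0 <= lam * mu * `|p t| ^+ 2 by rewrite mulr_ge0 ?sqr_ge0// ltW// mulr_gt0.
by rewrite /lyapunov; lra.
Qed.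

Lemma lyapunov_ge0 t : late t -> 0 <= lyapunov t.
Proof. by move=> /lyapunov_ge[+ _]; apply: le_trans; rewrite mulr_ge0 ?sqr_ge0. Qed.

Lemma lyapunov_drift_le t : late t ->
  (2 * t + (mu - 1) * beta) * F t - lam * (t - beta) * ip (p t) (g t)
  <= - ((lam - 2) / 2 * (t * ip (p t) (g t))).
Proof.
move=> [/time_ge0 t_ge0 _ /[!ler_norml]/andP[? ?] lam_t].
have gap_pg : (2 * t + (mu - 1) * beta) * F t
    <= (2 * t + (mu - 1) * beta) * ip (p t) (g t).
  by rewrite ler_wpM2l ?gap_le//; lra.
have pg_ge0 : 0 <= ip (p t) (g t) := le_trans (gap_ge0 t) (gap_le t).
by have := ler_wpM2r pg_ge0 lam_t; lra.
Qed.

Lemma time_velocity_le t : t0 <= t ->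
  t * `|q t| <= `|anchor t| + lam * `|p t| + beta * (t * `|w t|).
Proof.
move=> /time_ge0 t_ge0.
have : t *: q t = anchor t - lam *: p t - (beta * t) *: w t.
  by rewrite /anchor [lam *: _ + _]addrC addrK scalerDr scalerA (mulrC beta) addrK.
move=> /(congr1 Num.norm); rewrite normrZ (ger0_norm t_ge0) => ->.
rewrite (le_trans (ler_normB _ _))// normrZ ger0_norm ?mulr_ge0 ?(ltW beta_gt0)//.
by rewrite -mulrA lerD2r (le_trans (ler_normB _ _))// normrZ gtr0_norm.
Qed.

Lemma anchor_le_lyapunov t : late t -> `|anchor t| <= 1 + lyapunov t.
Proof.
by move=> /lyapunov_ge[+ _]; have := ler_half1Dsqr `|anchor t|; lra.
Qed.

Lemma displacement_le_lyapunov t : late t ->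
  lam * `|p t| <= (lam / 2 + mu^-1) * (1 + lyapunov t).
Proof.
move=> late_t; have E_ge0 := lyapunov_ge0 late_t; have [_ p_le] := lyapunov_ge late_t.
have mu_inv_ge0 : 0 <= mu^-1 by rewrite invr_ge0 ltW.
have sqr_p_le : lam / 2 * `|p t| ^+ 2 <= mu^-1 * lyapunov t.
  have -> : lam / 2 * `|p t| ^+ 2 = mu^-1 * (lam * mu / 2 * `|p t| ^+ 2).
    by field; rewrite gt_eqF.
  exact: ler_wpM2l.
have p_le_sqr : lam / 2 * (2 * `|p t|) <= lam / 2 * (1 + `|p t| ^+ 2).
  rewrite ler_wpM2l ?divr_ge0 ?(ltW lam_gt0)//.
  by have := ler_half1Dsqr `|p t|; lra.
have : 0 <= lam / 2 * lyapunov t by rewrite mulr_ge0 ?divr_ge0 ?(ltW lam_gt0).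
by lra.
Qed.

Definition perturbation_rate t : R :=
  (3 / 2 + 5 / 2 * (lam / 2 + mu^-1)) * (t * `|e t|)
  + 9 / 4 * beta * (t ^+ 2 * `|e t| ^+ 2).

Lemma perturbation_rate_integrable : ge0_integrable_from t0 perturbation_rate.
Proof.
apply: ge0_integrable_fromD; apply: ge0_integrable_fromZl => //.
- have mu_inv_gt0 : 0 < mu^-1 by rewrite invr_gt0.
  by have := lam_gt0; lra.
- by rewrite mulr_ge0// ltW.
- exact: time_sqr_perturbation_integrable.
Qed.

Lemma perturbation_factor_le t : late t -> `|perturbation_factor t| <=
  t * (5 / 2 * (lam * `|p t|) + 3 / 2 * `|anchor t| + 3 / 2 * (beta * (t * `|w t|))).
Proof.
move=> late_t; have [t0t beta_t _ _] := late_t; have t_ge0 := time_ge0 t0t.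
have /andP[weight_ge0 weight_le] := late_gap_weight late_t.
have lam_t_ge0 : 0 <= lam * (t - beta).
  by rewrite mulr_ge0 ?(ltW lam_gt0)// subr_ge0; have := beta_gt0; lra.
rewrite (le_trans (ler_normD _ _))// (normrZ (gap_weight t)) (normrZ (lam * _)).
rewrite (ger0_norm weight_ge0) (ger0_norm lam_t_ge0).
have p_le : lam * (t - beta) * `|p t| <= lam * t * `|p t|.
  by rewrite ler_wpM2r// ler_wpM2l ?(ltW lam_gt0)// gerBl ltW.
have := ler_wpM2r (normr_ge0 (q t)) weight_le.
by have := ler_wpM2l t_ge0 (time_velocity_le t0t); lra.
Qed.

Lemma lyapunov_perturbation_le t : late t ->
  - ip (perturbation_factor t) (e t)
  <= perturbation_rate t * (1 + lyapunov t) + beta / 4 * (t ^+ 2 * `|w t| ^+ 2).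
Proof.
move=> late_t; have [/time_ge0 t_ge0 _ _ _] := late_t.
have te_ge0 := mulr_ge0 t_ge0 (normr_ge0 (e t)).
have controlled : 5 / 2 * (lam * `|p t|) + 3 / 2 * `|anchor t|
    <= (3 / 2 + 5 / 2 * (lam / 2 + mu^-1)) * (1 + lyapunov t).
  have := displacement_le_lyapunov late_t; have := anchor_le_lyapunov late_t; lra.
have young : 3 / 2 * (t * `|w t|) * (t * `|e t|)
    <= 1 / 4 * (t ^+ 2 * `|w t| ^+ 2) + 9 / 4 * (t ^+ 2 * `|e t| ^+ 2).
  by have := sqr_ge0 (1 / 2 * (t * `|w t|) - 3 / 2 * (t * `|e t|)); lra.
apply: le_trans (_ : _ <= `|perturbation_factor t| * `|e t|) _.
  by rewrite lerNl; exact: (ip_ge_norm ipP).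
apply: le_trans (ler_wpM2r (normr_ge0 (e t)) (perturbation_factor_le late_t)) _.
have := ler_wpM2l (ltW beta_gt0) young; have := ler_wpM2r te_ge0 controlled.
have : 0 <= 9 / 4 * beta * (t ^+ 2 * `|e t| ^+ 2) * lyapunov t.
  by rewrite !mulr_ge0 ?sqr_ge0 ?(ltW beta_gt0) ?lyapunov_ge0.
by rewrite /perturbation_rate; lra.
Qed.

Definition dissipation t : R :=
  (lam - 2) / 2 * (t * ip (p t) (g t)) + mu * (t * `|q t| ^+ 2)
  + beta / 4 * (t ^+ 2 * `|w t| ^+ 2).

Lemma lyapunov_rate_le t : late t ->
  lyapunov_rate t <= perturbation_rate t * (1 + lyapunov t) - dissipation t.
Proof.
move=> late_t; have [/time_ge0 t_ge0 beta_t _ _] := late_t.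
have := lyapunov_drift_le late_t; have := lyapunov_perturbation_le late_t.
have : beta * (t * (t / 2)) * `|w t| ^+ 2 <= beta * (t * (t - beta)) * `|w t| ^+ 2.
  rewrite ler_wpM2r ?sqr_ge0// ler_wpM2l ?(ltW beta_gt0)// ler_wpM2l//; lra.
by rewrite /lyapunov_rate /dissipation; lra.
Qed.

Lemma dissipation_terms_le t : t0 <= t ->
  [/\ (lam - 2) / 2 * (t * ip (p t) (g t)) <= dissipation t,
      mu * (t * `|q t| ^+ 2) <= dissipation t &
      beta / 4 * (t ^+ 2 * `|w t| ^+ 2) <= dissipation t].
Proof.
move=> t0t; have t_ge0 := time_ge0 t0t.
have pg_term : 0 <= (lam - 2) / 2 * (t * ip (p t) (g t)).
  by rewrite mulr_ge0 ?time_ip_gradient_ge0// divr_ge0// subr_ge0 ltW.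
have q_term : 0 <= mu * (t * `|q t| ^+ 2) by rewrite !mulr_ge0 ?sqr_ge0 ?(ltW mu_gt0).
have w_term : 0 <= beta / 4 * (t ^+ 2 * `|w t| ^+ 2).
  by rewrite !mulr_ge0 ?sqr_ge0 ?(ltW beta_gt0).
by rewrite /dissipation; split; lra.
Qed.

Lemma dissipation_continuous : continuous_from t0 dissipation.
Proof.
move=> t t0t; apply: cvgD; first apply: cvgD.
- by apply: cvgM; [exact: cvg_cst|exact: time_ip_gradient_continuous].
- by apply: cvgM; [exact: cvg_cst|exact: time_sqr_velocity_continuous].
- apply: cvgM; first exact: cvg_cst.
  exact: (continuous_fromXM (continuous_from_sqr_norm w_cont) t0t).
Qed.

Lemma lyapunov_dissipation_integrable : ge0_integrable_from t0 dissipation.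
Proof.
have [T t0T late_T] := late_from.
have dissipation_ge0 t : t0 <= t -> 0 <= dissipation t.
  move=> t0t; have [_ + _] := dissipation_terms_le t0t; apply: le_trans.
  by have t_ge0 := time_ge0 t0t; rewrite !mulr_ge0 ?sqr_ge0 ?(ltW mu_gt0).
apply: (ge0_integrable_from_extend t0T dissipation_continuous dissipation_ge0).
apply: (@gronwall_dissipation _ T lyapunov lyapunov_rate perturbation_rate).
- by move=> t /(le_trans t0T); exact: is_derive_lyapunov.
- by move=> t /late_T; exact: lyapunov_ge0.
- exact: ge0_integrable_from_tail t0T perturbation_rate_integrable.
- by move=> t /(le_trans t0T); exact: dissipation_continuous.
- by move=> t /(le_trans t0T); exact: dissipation_ge0.
- by move=> t /late_T; exact: lyapunov_rate_le.
Qed.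

End Lyapunov.

Hypothesis alpha_gt3 : 3 < alpha.

Lemma dissipated_integrable : [/\
  ge0_integrable_from t0 (fun t => t * ip (p t) (g t)),
  ge0_integrable_from t0 (fun t => t * `|q t| ^+ 2) &
  ge0_integrable_from t0 (fun t => t ^+ 2 * `|w t| ^+ 2)].
Proof.
pose lam := (alpha + 1) / 2; pose mu := alpha - 1 - lam.
have lam_gt2 : 2 < lam by have := alpha_gt3; rewrite /lam; lra.
have mu_gt0 : 0 < mu by have := alpha_gt3; rewrite /mu /lam; lra.
have terms_le := dissipation_terms_le lam_gt2 mu_gt0.
have dissipation_int := lyapunov_dissipation_integrable lam_gt2 mu_gt0.
split.
- apply: (ge0_integrable_from_leZl (c := (lam - 2) / 2)) dissipation_int
    => [|||t /terms_le[]//].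
  + by rewrite divr_gt0// subr_gt0.
  + exact: time_ip_gradient_continuous.
  + exact: time_ip_gradient_ge0.
- apply: (ge0_integrable_from_leZl mu_gt0) dissipation_int => [||t /terms_le[]//].
  + exact: time_sqr_velocity_continuous.
  + by move=> t /time_ge0 t_ge0; rewrite mulr_ge0 ?sqr_ge0.
- apply: (ge0_integrable_from_leZl (c := beta / 4)) dissipation_int
    => [|||t /terms_le[]//].
  + by rewrite divr_gt0.
  + exact: continuous_fromXM (continuous_from_sqr_norm w_cont).
  + by move=> t _; rewrite mulr_ge0 ?sqr_ge0.
Qed.

Lemma time_ip_gradient_integrable : ge0_integrable_from t0 (fun t => t * ip (p t) (g t)).
Proof. by have [] := dissipated_integrable. Qed.

Lemma time_sqr_velocity_integrable : ge0_integrable_from t0 (fun t => t * `|q t| ^+ 2).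
Proof. by have [] := dissipated_integrable. Qed.

Lemma time_gap_integrable : ge0_integrable_from t0 (fun t => t * F t).
Proof.
apply: ge0_integrable_from_le time_ip_gradient_integrable => [|t /time_ge0 t_ge0].
  exact: continuous_from_idM (is_derive_from_continuous is_derive_gap).
by rewrite mulr_ge0 ?gap_ge0// ler_wpM2l ?gap_le.
Qed.

Lemma time_sqr_gradient_integrable :
  ge0_integrable_from t0 (fun t => t ^+ 2 * `|g t| ^+ 2).
Proof.
have [_ _ w_int] := dissipated_integrable.
have w_int2 := ge0_integrable_fromZl (ler0n _ 2) w_int.
have e_int2 := ge0_integrable_fromZl (ler0n _ 2) time_sqr_perturbation_integrable.
apply: ge0_integrable_from_le (ge0_integrable_fromD w_int2 e_int2) => [|t t0t].
  exact: continuous_fromXM (continuous_from_sqr_norm g_cont).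
rewrite mulr_ge0 ?sqr_ge0//=.
have : `|g t| ^+ 2 <= 2 * `|w t| ^+ 2 + 2 * `|e t| ^+ 2.
  have := sqr_ge0 `|w t + e t|; rewrite (sqr_normD ipP).
  have : `|g t| ^+ 2 = `|w t - e t| ^+ 2 by rewrite /w addrK.
  by rewrite (sqr_normB ipP); lra.
by move=> /(ler_wpM2l (sqr_ge0 t)); lra.
Qed.

Definition kinetic t : R := t ^+ 2 * (F t + 2^-1 * `|q t| ^+ 2).

Definition kinetic_rate t : R :=
  2 * (t * F t) - (alpha - 1) * (t * `|q t| ^+ 2)
  - beta * (t ^+ 2 * ip (q t) (derive1 w t)) - t ^+ 2 * ip (q t) (e t).

Lemma is_derive_kinetic : is_derive_from t0 kinetic kinetic_rate.
Proof.
move=> t t0t; have t_neq0 : t != 0 by rewrite gt_eqF// time_gt0.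
have energyE := is_deriveD (is_derive_gap t0t)
  (is_deriveZ 2^-1 (is_derive_sqr_norm ipP (qE t0t))).
apply: is_derive_eq (is_deriveM (is_deriveX 2 (is_derive_id t 1)) energyE) _.
rewrite /= !fctE /= /kinetic_rate; move: (derive1 w t) => dwt.
rewrite /w; move: (q t) (g t) (e t) (F t) => qt gt et Ft.
rewrite -!(ip_sqr ipP) !(ipDr ipP, ipNr ipP, ipZr ipP) (ipC ipP gt qt) /GRing.scale/=.
by field.
Qed.

Lemma kinetic_ge0 t : 0 <= kinetic t.
Proof. by rewrite mulr_ge0 ?sqr_ge0// addr_ge0 ?gap_ge0// mulr_ge0 ?sqr_ge0. Qed.

Lemma kinetic_ge_sqr_velocity t : 2^-1 * (t * `|q t|) ^+ 2 <= kinetic t.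
Proof. by rewrite /kinetic exprMn; have := mulr_ge0 (sqr_ge0 t) (gap_ge0 t); lra. Qed.

Lemma time_ip_velocity_ge t (u : H) : t0 <= t ->
  - (t ^+ 2 * ip (q t) u) <= t * `|u| * (1 + kinetic t).
Proof.
move=> /time_ge0 t_ge0; have := ip_ge_norm ipP (q t) u.
move=> /(ler_wpM2l (sqr_ge0 t)) ip_ge.
have : t * `|q t| <= 1 + kinetic t.
  by have := ler_half1Dsqr (t * `|q t|); have := kinetic_ge_sqr_velocity t; lra.
by move=> /(ler_wpM2l (mulr_ge0 t_ge0 (normr_ge0 u))); lra.
Qed.

Lemma kinetic_rate_le t : t0 <= t -> kinetic_rate t <=
  (2 * (t * F t) + t * `|e t| + beta * (t * `|derive1 e t|)) * (1 + kinetic t).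
Proof.
move=> t0t; have t_ge0 := time_ge0 t0t.
have gap_term : 0 <= 2 * (t * F t) * kinetic t.
  by rewrite mulr_ge0 ?kinetic_ge0// !mulr_ge0 ?gap_ge0.
have friction_term : 0 <= (alpha - 1) * (t * `|q t| ^+ 2).
  by rewrite !mulr_ge0 ?sqr_ge0//; have := alpha_gt3; lra.
have hessian_term : 0 <= beta * (t ^+ 2 * ip (q t) (derive1 w t - derive1 e t)).
  by rewrite !mulr_ge0 ?sqr_ge0 ?gradient_derive_velocity_ge0 ?(ltW beta_gt0).
have := time_ip_velocity_ge (e t) t0t.
have := ler_wpM2l (ltW beta_gt0) (time_ip_velocity_ge (derive1 e t) t0t).
by move: hessian_term; rewrite (ipDr ipP) (ipNr ipP) /kinetic_rate; lra.
Qed.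

Lemma kinetic_cvg0 : kinetic @ +oo --> 0.
Proof.
apply: (cvg0_div_id_integrable t0_gt0).
  have half_velocity_int : ge0_integrable_from t0 (fun t => 2^-1 * (t * `|q t| ^+ 2)).
    exact: ge0_integrable_fromZl time_sqr_velocity_integrable.
  have rate_int := ge0_integrable_fromD time_gap_integrable half_velocity_int.
  apply: ge0_integrable_from_le rate_int => t t0t; have t_gt0 := time_gt0 t0t.
    apply: cvgM; first exact: (is_derive_from_continuous is_derive_kinetic t0t).
    by apply: inv_continuous; rewrite gt_eqF.
  have <- : kinetic t / t = t * F t + 2^-1 * (t * `|q t| ^+ 2).
    by rewrite /kinetic; field; rewrite gt_eqF.
  by rewrite divr_ge0 ?kinetic_ge0 ?(ltW t_gt0)/=.
apply: gronwall_cvg is_derive_kinetic (fun t _ => kinetic_ge0 t) _ kinetic_rate_le.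
apply: ge0_integrable_fromD; last exact: ge0_integrable_fromZl (ltW beta_gt0) de_int.
by apply: ge0_integrable_fromD e_int; exact: ge0_integrable_fromZl time_gap_integrable.
Qed.

Lemma time_sqr_gap_cvg0 : (fun t => t ^+ 2 * F t) @ +oo --> 0.
Proof.
apply: (squeeze_cvgr _ (cvg_cst 0) kinetic_cvg0); apply: nearW => t.
rewrite mulr_ge0 ?sqr_ge0 ?gap_ge0//= /kinetic ler_wpM2l ?sqr_ge0//.
by rewrite lerDl mulr_ge0 ?sqr_ge0.
Qed.

Lemma time_velocity_cvg0 : (fun t => t * `|q t|) @ +oo --> 0.
Proof.
have sqr_cvg0 : (fun t => (t * `|q t|) ^+ 2) @ +oo --> 0.
  have kinetic2_cvg0 : (fun t => 2 * kinetic t) @ +oo --> 0.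
    by rewrite -(mulr0 2); apply: cvgM; [exact: cvg_cst|exact: kinetic_cvg0].
  apply: (squeeze_cvgr _ (cvg_cst 0) kinetic2_cvg0); apply: nearW => t.
  by rewrite sqr_ge0/=; have := kinetic_ge_sqr_velocity t; lra.
have := cvg_comp _ _ sqr_cvg0 (@sqrt_continuous R 0); rewrite sqrtr0.
apply: cvg_trans; apply: near_eq_cvg; near=> t; rewrite /= sqrtr_sqr ger0_norm//.
by rewrite mulr_ge0// time_ge0//; near: t; apply: nbhs_pinfty_ge; exact: num_real.
Unshelve. all: end_near. Qed.

Lemma trajectory_estimates : [/\ (fun t => t ^+ 2 * F t) @ +oo --> 0,
    (fun t => t * `|q t|) @ +oo --> 0 &
  [/\ (\int[lebesgue_measure]_(t in `[t0, +oo[) (t ^+ 2 * `|g t| ^+ 2)%:E < +oo)%E,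
    (\int[lebesgue_measure]_(t in `[t0, +oo[) (t * F t)%:E < +oo)%E,
    (\int[lebesgue_measure]_(t in `[t0, +oo[) (t * ip (g t) (p t))%:E < +oo)%E &
    (\int[lebesgue_measure]_(t in `[t0, +oo[) (t * `|q t| ^+ 2)%:E < +oo)%E]].
Proof.
split; [exact: time_sqr_gap_cvg0|exact: time_velocity_cvg0|split].
- exact: ge0_integrable_from_lty time_sqr_gradient_integrable.
- exact: ge0_integrable_from_lty time_gap_integrable.
- under eq_integral do rewrite (ipC ipP).
  exact: ge0_integrable_from_lty time_ip_gradient_integrable.
- exact: ge0_integrable_from_lty time_sqr_velocity_integrable.
Qed.

End Trajectory.

Lemma inf_range_min (R : realType) (T : Type) (f : T -> R) xs :
  (forall y, f xs <= f y) -> inf (range f) = f xs.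
Proof.
move=> xs_min; apply/eqP; rewrite eq_le; apply/andP; split.
  by apply: ge_inf; [exists (f xs) => _ [y _ <-]|exists xs].
by apply: lb_le_inf; [exists (f xs), xs|move=> _ [y _ <-]].
Qed.

Theorem theorem5 (R : realType) (H : completeNormedModType R)
  (ip : H -> H -> R) (t0 : R) (f : H -> R) (gradf : H -> H)
  (e : R -> H) (alpha beta : R) (x : R -> H) :
  is_inner_product ip ->
  0 < t0 ->
  convex_fun f ->
  C2_fun ip f gradf ->
  (exists xs : H, forall y, f xs <= f y) ->
  (* e is C^1 on [t0, +oo[ *)
  (forall t, t0 <= t -> derivable e t 1) ->
  (forall t, t0 <= t -> {for t, continuous (derive1 e)}) ->
  (\int[lebesgue_measure]_(t in `[t0, +oo[) (t * `|e t|)%:E < +oo)%E ->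
  (\int[lebesgue_measure]_(t in `[t0, +oo[) (t * `|derive1 e t|)%:E < +oo)%E ->
  3 < alpha -> 0 < beta ->
  (* x is a (classical, C^2) solution trajectory on [t0, +oo[ *)
  (forall t, t0 <= t -> derivable x t 1) ->
  (forall t, t0 <= t -> derivable (derive1 x) t 1) ->
  (forall t, t0 <= t -> {for t, continuous (derive1n 2 x)}) ->
  (forall t, t0 <= t -> derivable (fun s => gradf (x s) + e s) t 1) ->
  (forall t, t0 <= t ->
     derive1n 2 x t + (alpha / t) *: derive1 x t
     + beta *: derive1 (fun s => gradf (x s) + e s) t
     + (gradf (x t) + e t) = 0) ->
  (* (i) *)
      (fun t => t ^+ 2 * (f (x t) - inf (range f))) @ +oo --> 0 /\
      (* (ii) *)
      (\int[lebesgue_measure]_(t in `[t0, +oo[) (t ^+ 2 * `|gradf (x t)| ^+ 2)%:E < +oo)%E /\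
      (* (iii) *)
      (\int[lebesgue_measure]_(t in `[t0, +oo[) (t * (f (x t) - inf (range f)))%:E < +oo)%E /\
      (* (iv) *)
      (forall xs : H, (forall y, f xs <= f y) ->
        (\int[lebesgue_measure]_(t in `[t0, +oo[) (t * ip (gradf (x t)) (x t - xs))%:E < +oo)%E) /\
      (* (v) *)
      (\int[lebesgue_measure]_(t in `[t0, +oo[) (t * `|derive1 x t| ^+ 2)%:E < +oo)%E /\
      (* (vi) *)
      (fun t => t * `|derive1 x t|) @ +oo --> 0.
Proof.
move=> ipP t0_gt0 f_convex [f_grad _] [xm xm_min] de cde e_lty de_lty alpha_gt3 beta_gt0.
move=> dx ddx _ dw ode; have eE := derivable_is_derive_from de.
have ce := is_derive_from_continuous eE.
have e_int := time_norm_ge0_integrable_from (ltW t0_gt0) ce e_lty.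
have de_int := time_norm_ge0_integrable_from (ltW t0_gt0) cde de_lty.
have estimates xs (xs_min : forall y, f xs <= f y) :=
  trajectory_estimates ipP f_convex f_grad xs_min t0_gt0 beta_gt0 eE e_int de_int
    (derivable_is_derive_from dx) (derivable_is_derive_from dw)
    (derivable_is_derive_from ddx) ode alpha_gt3.
rewrite (inf_range_min xm_min).
have [gap_cvg0 velocity_cvg0 [gradient_lty gap_lty _ velocity_lty]] := estimates _ xm_min.
by do !split => //; move=> xs /estimates[_ _ []].
Qed.
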